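(* Let $(W,w)=\{(W_i,\omega_i)\}_{i\in I_m}$ be a fusion frame for a finite-dimensional Hilbert space $\mathcal{H}$ and let $U\in B(\mathcal{H})$ be a unitary operator. Then $(V,v)=\{(V_i,\nu_i)\}_{i\in I_m}$ is a $1$-loss optimal dual fusion frame of $(W,w)$ if and only if $\{(UV_i,\nu_i)\}_{i\in I_m}$ is a $1$-loss optimal dual fusion frame of $\{(UW_i,\omega_i)\}_{i\in I_m}$.
   Context: $I_m=\{1,\dots,m\}$; $B(\mathcal{H})$ is the space of bounded linear operators on $\mathcal{H}$; $\pi_X$ is the orthogonal projection onto a subspace $X$; $\|\cdot\|_F$ is the Frobenius norm. A family $(W,w)=\{(W_i,\omega_i)\}_{i\in I_m}$ of subspaces of $\mathcal{H}$ with weights $\omega_i>0$ is a fusion frame for $\mathcal{H}$ if $\operatorname{span}\bigcup_iW_i=\mathcal{H}$; its fusion frame operator $S_Wf=\sum_{i\in I_m}\omega_i^2\pi_{W_i}f$ is positive and invertible. Fusion frames are assumed non-trivial: $W_i\ne\mathcal{H}$ for at least one $i$. A family $(V,v)=\{(V_i,\nu_i)\}_{i\in I_m}$ of subspaces with weights $\nu_i>0$ is a dual fusion frame of $(W,w)$ if $\sum_{i\in I_m}\omega_i\nu_i\pi_{V_i}S_W^{-1}\pi_{W_i}=I_{\mathcal{H}}$; $D_W$ denotes the set of all of these. $(V,v)\in D_W$ is a $1$-loss optimal dual fusion frame of $(W,w)$ if $$\max_{i\in I_m}\|\omega_i\nu_i\pi_{V_i}S_W^{-1}\pi_{W_i}\|_F=\inf\Big\{\max_{i\in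 I_m}\|\omega_iz_i\pi_{Z_i}S_W^{-1}\pi_{W_i}\|_F:(Z,z)\in D_W\Big\}.$$ *)

(* Defs.v *)
From HB Require Import structures.
From mathcomp Require Import all_boot all_order all_algebra.
From mathcomp Require Import complex.
From mathcomp Require Import boolp classical_sets reals.

Set Implicit Arguments.
Unset Strict Implicit.
Unset Printing Implicit Defensive.

Import Order.TTheory GRing.Theory Num.Theory.

Local Open Scope ring_scope.
Local Open Scope classical_set_scope.

(* A finite-dimensional Hilbert space is a vectType over the reals or the
   complex numbers together with a positive definite form {dot H for conj},
   linear in its first argument. Norms, weights and losses are real numbers. *)

Inductive scalar_kind := RealScalars | ComplexScalars.

Definition scalars (R : realType) (k : scalar_kind) : numFieldType :=
  match k with RealScalars => R | ComplexScalars => R[i] end.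

Definition conj_scalar (R : realType) (k : scalar_kind) :
    involutive_rmorphism (scalars R k) :=
  match k return involutive_rmorphism (scalars R k) with
  | RealScalars => @idfun R
  | ComplexScalars => @Num.conj R[i]
  end.
Arguments conj_scalar : clear implicits.

Definition of_real (R : realType) (k : scalar_kind) : R -> scalars R k :=
  match k return R -> scalars R k with
  | RealScalars => fun x => x
  | ComplexScalars => fun x => x%:C%C
  end.
Arguments of_real : clear implicits.

Definition real_part (R : realType) (k : scalar_kind) : scalars R k -> R :=
  match k return scalars R k -> R with
  | RealScalars => fun x => x
  | ComplexScalars => fun x => complex.Re x
  end.
Arguments real_part : clear implicits.

Notation hilbert_dot R k H := {dot H for conj_scalar R k}.

Section Operators.
Variables (R : realType) (k : scalar_kind) (H : vectType (scalars R k)).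
Variable ip : hilbert_dot R k H.

Definition is_adjoint (A B : 'End(H)) := forall x y, ip (A x) y = ip x (B y).

(* The default value 0 is never reached: see adjointP. *)
Definition adjoint (A : 'End(H)) : 'End(H) :=
  xget 0 [set B | is_adjoint A B].

Lemma dot_eq0 u : ip u u = 0 -> u = 0.
Proof.
move=> uu; apply/eqP/negPn/negP => u0.
by have := neq0_dnorm_gt0 (s := ip) u u0; rewrite uu ltxx.
Qed.

Lemma adjointP (A : 'End(H)) : is_adjoint A (adjoint A).
Proof.
suff [B AB] : exists B, is_adjoint A B.
  exact: (@xgetPex _ 0 [set B | is_adjoint A B] (ex_intro _ B AB)).
pose th := conj_scalar R k.
pose e := vbasis {:H}; have eb : basis_of {:H} e by exact: vbasisP.
pose n := \dim {:H}.
pose G : 'M[scalars R k]_n := \matrix_(i, j) ip e`_i e`_j.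
have mxE_app (C : 'End(H)) (i : 'I_n) :
    C e`_i = \sum_j passmx.mxof e e C i j *: e`_j.
  rewrite -[LHS](passmx.rVofK eb) (passmx.rVof_app e eb) passmx.rVofE // -rowE.
  by rewrite /passmx.vecof; apply: eq_bigr => j _; rewrite mxE.
have GU : G \in unitmx.
  rewrite -row_free_unit; apply: inj_row_free => u uG.
  apply/eqP; rewrite -(passmx.vecof_eq0 eb); apply/eqP/dot_eq0.
  set x := passmx.vecof e u.
  have xe (j : 'I_n) : ip x e`_j = 0.
    move/rowP/(_ j): uG; rewrite !mxE => xj; rewrite -[RHS]xj.
    rewrite /x /passmx.vecof linear_sumlz; apply: eq_bigr => i _.
    by rewrite linearZl_LR !mxE.
  rewrite {2}(coord_basis eb (memvf x)) linear_sumr big1 // => j _.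
  by rewrite linearZr_LR /= xe mulr0.
pose M := passmx.mxof e e A.
pose N := (map_mx th (invmx G *m M *m G))^T.
pose B := passmx.hommx e e N.
have key (i j : 'I_n) : ip (A e`_i) e`_j = ip e`_i (B e`_j).
  rewrite !mxE_app passmx.hommxK // linear_sumlz linear_sumr.
  transitivity ((M *m G) i j).
    by rewrite !mxE; apply: eq_bigr => l _; rewrite linearZl_LR !mxE.
  transitivity ((G *m (invmx G *m M *m G)) i j).
    by rewrite -mulmxA mulKVmx.
  rewrite mxE; apply: eq_bigr => l _.
  by rewrite linearZr_LR /= [N]lock !mxE -lock /N !mxE rmorphK mulrC.
exists B => x y.
rewrite (coord_basis eb (memvf x)) linear_sum !linear_sumlz.
apply: eq_bigr => i _; rewrite linearZ !linearZl_LR; congr (_ * _).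
rewrite (coord_basis eb (memvf y)) [B _]linear_sum /=.
set a := A _; rewrite linear_sumr [RHS]linear_sumr /=.
apply: eq_bigr => j _; rewrite linearZr_LR [B _]linearZ.
by rewrite [RHS]linearZr_LR /= key.
Qed.

Definition unitary (U : 'End(H)) :=
  (adjoint U \o U)%VF = \1%VF /\ (U \o adjoint U)%VF = \1%VF.

(* The projection onto X along its orthogonal complement. *)
Definition orthproj (X : {vspace H}) : 'End(H) := daddv_pi X (orthov ip X).

Lemma orthprojP (X : {vspace H}) x :
  orthproj X x \in X /\ x - orthproj X x \in orthov ip X.
Proof.
have X0 : (X :&: orthov ip X = 0)%VS.
  apply/eqP; rewrite -subv0; apply/subvP => u; rewrite memv_cap => /andP[uX].
  by move=> /mem_orthovP/(_ u uX)/dot_eq0 ->; rewrite mem0v.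
have XT : (X + orthov ip X = fullv)%VS.
  pose g (u : H) : 'rV[scalars R k]_(\dim X) := \row_i ip u (vbasis X)`_i.
  have gL : linear g by move=> a u v; apply/rowP => i; rewrite !mxE linearPl.
  pose gM := GRing.isLinear.Build _ _ _ _ g gL.
  pose G : {linear H -> 'rV[scalars R k]_(\dim X)} := HB.pack g gM.
  have kG : (lker (linfun G) <= orthov ip X)%VS.
    apply/subvP => u; rewrite memv_ker lfunE /= => /eqP/rowP gu.
    apply/mem_orthovP => v /coord_vbasis ->; rewrite linear_sumr big1 // => i _.
    by rewrite linearZr_LR /=; have := gu i; rewrite !mxE => ->; rewrite mulr0.
  apply/eqP; rewrite eqEdim subvf /= dimv_disjoint_sum //.
  rewrite -(limg_ker_dim (linfun G) fullv) capfv addnC leq_add ?dimvS //.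
  by rewrite (leq_trans (dimvS (subvf _))) // dimvf /dim /= mul1n.
split; first exact: memv_pi.
rewrite -[x in X in X - _](daddv_pi_add X0 (w := x)) ?XT ?memvf //.
by rewrite addrC addKr; exact: memv_pi.
Qed.

Definition trace (A : 'End(H)) : scalars R k :=
  \tr (passmx.mxof (vbasis fullv) (vbasis fullv) A).

Definition frobenius (A : 'End(H)) : R :=
  Num.sqrt (real_part R k (trace (adjoint A \o A)%VF)).

End Operators.

Section FusionFrames.
Variables (R : realType) (k : scalar_kind) (H : vectType (scalars R k)).
Variables (ip : hilbert_dot R k H) (m : nat).
Implicit Types (W V : 'I_m -> {vspace H}) (w v : 'I_m -> R).

Definition fusion_frame W w :=
  (forall i, 0 < w i) /\ (\sum_i W i)%VS = fullv.

Definition nontrivial W := exists i, W i <> fullv.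

Definition fusion_op W w : 'End(H) :=
  \sum_i of_real R k (w i ^+ 2) *: orthproj ip (W i).

Definition loss_op W w V v (i : 'I_m) : 'End(H) :=
  of_real R k (w i * v i) *:
    (orthproj ip (V i) \o ((fusion_op W w)^-1 \o orthproj ip (W i)))%VF.

Definition dual_fusion_frame W w V v :=
  (forall i, 0 < v i) /\ \sum_i loss_op W w V v i = \1%VF.

(* Norms are nonnegative and m > 0 for nontrivial families, so the default 0
   of the maximum plays no role. *)
Definition one_loss W w V v : R :=
  \big[Num.max/0]_(i < m) frobenius ip (loss_op W w V v i).

Definition one_loss_optimal W w V v :=
  dual_fusion_frame W w V v /\
  one_loss W w V v =
    inf [set r | exists Z z, dual_fusion_frame W w Z z /\ r = one_loss W w Z z].

End FusionFrames.

(* Main.v *)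
(** The projection onto [U X] is [U P_X U*], so the fusion frame operator, its
    inverse and the loss operators of the transported families are those of the
    original families conjugated by [U]. Conjugation preserves the identity and,
    the trace being cyclic, the Frobenius norm. Hence [U] maps the duals of [W]
    bijectively (with inverse [U*]) onto the duals of [U W], preserving losses. *)

Require Import Defs.
From mathcomp Require Import all_boot all_order all_algebra reals.
From mathcomp Require Import complex classical_sets.

Set Implicit Arguments.
Unset Strict Implicit.
Unset Printing Implicit Defensive.

Import Order.TTheory GRing.Theory Num.Theory.

Local Open Scope ring_scope.

(** [f^-1] is total and a genuine inverse only when the kernel is trivial. A left inverse forces
    that, and finite dimension then makes [f^-1] two-sided. *)
Lemma invlf_uniq (F : fieldType) (V : vectType F) (f g : 'End(V)) :
  (g \o f = \1)%VF -> (f^-1)%VF = g.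
Proof.
move=> gf; have f0 : lker f == 0%VS.
  by apply/lker0P => x y /(congr1 g); rewrite -!comp_lfunE gf !id_lfunE.
by rewrite -[LHS]comp_lfun1l -gf -comp_lfunA lker0_compfV // comp_lfun1r.
Qed.

Lemma of_real_ge0 (R : realType) k (x : R) : (0 <= of_real R k x) = (0 <= x).
Proof. by case: k => //=; rewrite lecR. Qed.

Lemma of_real_eq0 (R : realType) k (x : R) : (of_real R k x == 0) = (x == 0).
Proof. by case: k => //=; rewrite fmorph_eq0. Qed.

Section Operators.
Variables (R : realType) (k : scalar_kind) (H : vectType (scalars R k)).
Variable ip : hilbert_dot R k H.
Implicit Types (A B U : 'End(H)) (X : {vspace H}).

Lemma dot_ge0 x : 0 <= ip x x.
Proof.
have [->|x0] := eqVneq x 0; first by rewrite linear0l.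
exact/ltW/(neq0_dnorm_gt0 (s := ip)).
Qed.

(** Two candidates differ by a vector lying both in [X] and in its orthogonal complement, hence
    orthogonal to itself. *)
Lemma orthproj_uniq X x p :
  p \in X -> x - p \in orthov ip X -> orthproj ip X x = p.
Proof.
move=> pX xp; have [qX xq] := orthprojP ip X x; set q := orthproj _ _ _ in qX xq *.
have d : p - q = (x - q) - (x - p) by rewrite opprB [RHS]addrC subrKA.
apply/esym/eqP; rewrite -subr_eq0; apply/eqP/(@dot_eq0 _ _ _ ip).
by have/mem_orthovP := memvB xq xp; rewrite -d; apply; apply: memvB.
Qed.

Lemma dot_orthproj X x : ip (orthproj ip X x) x = ip (orthproj ip X x) (orthproj ip X x).
Proof.
have [pX xp] := orthprojP ip X x; move/mem_orthovP/(_ _ pX)/eqP: xp.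
by rewrite herm_eq0C linearBr subr_eq0 => /eqP.
Qed.

(** Definiteness leaves no choice in [adjoint]: at each [y], two adjoints differ by a vector
    orthogonal to everything, itself included. *)
Lemma adjoint_uniq A B : is_adjoint ip A B -> adjoint ip A = B.
Proof.
move=> AB; apply/lfunP => y; apply/eqP; rewrite -subr_eq0.
apply/eqP/(@dot_eq0 _ _ _ ip); rewrite linearBr; apply/eqP; rewrite subr_eq0.
by apply/eqP; exact: etrans (esym (adjointP ip A _ y)) (AB _ y).
Qed.

Lemma adjointK A : adjoint ip (adjoint ip A) = A.
Proof.
apply: adjoint_uniq => x y; rewrite hermC [RHS]hermC.
by congr (_ * conj_scalar R k _); exact/esym/adjointP.
Qed.

Lemma unitary_adjoint U : unitary ip U -> unitary ip (adjoint ip U).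
Proof. by case=> UU UV; split; rewrite adjointK. Qed.

Lemma unitary_dot U x y : unitary ip U -> ip (U x) (U y) = ip x y.
Proof. by case=> UU _; rewrite adjointP -comp_lfunE UU id_lfunE. Qed.

Lemma unitary_imgK U X : unitary ip U -> (adjoint ip U @: (U @: X) = X)%VS.
Proof. by case=> UU _; rewrite -limg_comp UU lim1g. Qed.

Lemma traceC A B : trace (A \o B)%VF = trace (B \o A)%VF.
Proof. by rewrite /trace !(passmx.mxof_comp _ _ (vbasisP fullv)) mxtrace_mulC. Qed.

(** For unitary [U] this is [U A U^-1], a star-automorphism of the algebra of operators. *)
Definition conjU U A : 'End(H) := (U \o (A \o adjoint ip U))%VF.

Section Conjugation.
Variable U : 'End(H).
Hypothesis unitU : unitary ip U.

Lemma conjU1 : conjU U \1 = \1%VF.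
Proof. by rewrite /conjU comp_lfun1l (proj2 unitU). Qed.

Lemma conjU_comp A B : conjU U (A \o B)%VF = (conjU U A \o conjU U B)%VF.
Proof.
rewrite /conjU -!comp_lfunA; congr (_ \o (_ \o _))%VF.
by rewrite [RHS]comp_lfunA (proj1 unitU) comp_lfun1l.
Qed.

Lemma conjUZ a A : conjU U (a *: A) = a *: conjU U A.
Proof. by rewrite /conjU -comp_lfunZl -comp_lfunZr. Qed.

Lemma conjU_sum I (r : seq I) (P : pred I) (F : I -> 'End(H)) :
  conjU U (\sum_(i <- r | P i) F i) = \sum_(i <- r | P i) conjU U (F i).
Proof.
apply: (big_morph (conjU U)) => [A B|].
  by rewrite /conjU comp_lfunDl comp_lfunDr.
by rewrite /conjU comp_lfun0l comp_lfun0r.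
Qed.

(** The trivial kernel gives [A^-1 \o A = \1]; conjugating this identity exhibits a left inverse of
    [conjU U A]. *)
Lemma conjU_inv A : lker A == 0%VS -> conjU U A^-1 = ((conjU U A)^-1)%VF.
Proof.
move=> A0; apply/esym/invlf_uniq.
by rewrite -conjU_comp lker0_compVf // conjU1.
Qed.

Lemma conjU_adjoint A : conjU U (adjoint ip A) = adjoint ip (conjU U A).
Proof.
apply/esym/adjoint_uniq => x y; rewrite /conjU !comp_lfunE.
by rewrite !adjointP adjointK.
Qed.

Lemma conjU_trace A : trace (conjU U A) = trace A.
Proof. by rewrite traceC -comp_lfunA (proj1 unitU) comp_lfun1r. Qed.

Lemma conjU_frobenius A : frobenius ip (conjU U A) = frobenius ip A.
Proof. by rewrite /frobenius -conjU_adjoint -conjU_comp conjU_trace. Qed.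

(** Since [U] preserves inner products, it carries the decomposition of [adjoint U y] along [X] and
    its complement to that of [y] along [U @: X]. *)
Lemma conjU_orthproj X : orthproj ip (U @: X) = conjU U (orthproj ip X).
Proof.
apply/lfunP => y; rewrite /conjU !comp_lfunE; set x := adjoint ip U y.
have [pX xp] := orthprojP ip X x; apply: orthproj_uniq; first exact: memv_img.
have -> : y = U x by rewrite -comp_lfunE (proj2 unitU) id_lfunE.
rewrite -linearB; apply/mem_orthovP => _ /memv_imgP[v vX ->].
by apply: etrans (unitary_dot _ _ unitU) _; move/mem_orthovP: xp; apply.
Qed.

End Conjugation.
End Operators.

Section FusionFrames.
Variables (R : realType) (k : scalar_kind) (H : vectType (scalars R k)).
Variables (ip : hilbert_dot R k H) (m : nat).
Implicit Types (W V Z : 'I_m -> {vspace H}) (w v z : 'I_m -> R) (U : 'End(H)).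

(** If [S x = 0], then [ip (S x) x], a weighted sum of the squared norms of the projections of [x],
    vanishes. So [x] is orthogonal to every [W i], hence to the whole space. *)
Lemma fusion_op_inj W w : fusion_frame W w -> lker (fusion_op ip W w) == 0%VS.
Proof.
case=> w_gt0 Wfull; rewrite -subv0; apply/subvP => x.
rewrite memv_ker memv0 => /eqP Sx.
pose q i := ip (orthproj ip (W i) x) (orthproj ip (W i) x).
have q0 : \sum_i of_real R k (w i ^+ 2) * q i = 0.
  transitivity (ip (fusion_op ip W w x) x); last by rewrite Sx linear0l.
  rewrite sum_lfunE linear_sumlz; apply: eq_bigr => i _.
  by rewrite lfunE linearZl_LR /= dot_orthproj.
have Px i : orthproj ip (W i) x = 0.
  (* For complex scalars [0 <=] also asserts that the term is real. *)
  have term_ge0 j : 0 <= of_real R k (w j ^+ 2) * q j.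
    by rewrite mulr_ge0 ?dot_ge0 // of_real_ge0 sqr_ge0.
  have /eqP := psumr_eq0P (fun j _ => term_ge0 j) q0 (i := i) isT.
  rewrite mulf_eq0 of_real_eq0 expf_eq0 gt_eqF //= => /eqP.
  exact: dot_eq0.
have xW : x \in orthov ip (\sum_i W i)%VS.
  (* Orthogonality to a sum is turned into an inclusion of that sum in the complement of the line of
     [x], which can be checked on each summand. *)
  rewrite mem_orthov_sym; apply/subv_sumP => i _; rewrite -mem_orthov_sym.
  by have [_] := orthprojP ip (W i) x; rewrite Px subr0.
by apply/eqP/(@dot_eq0 _ _ _ ip)/(mem_orthovP xW); rewrite Wfull memvf.
Qed.

Lemma fusion_frame_img U W w : unitary ip U ->
  fusion_frame W w -> fusion_frame (fun i => U @: W i)%VS w.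
Proof.
case=> _ UU [w_gt0 Wfull]; split=> //; rewrite -limg_sum Wfull.
apply/eqP; rewrite eqEsubv subvf; apply/subvP => y _.
by rewrite -[y]id_lfunE -UU comp_lfunE memv_img ?memvf.
Qed.

Lemma fusion_op_img U W w : unitary ip U ->
  fusion_op ip (fun i => U @: W i)%VS w = conjU ip U (fusion_op ip W w).
Proof.
move=> unitU; rewrite conjU_sum; apply: eq_bigr => i _.
by rewrite conjUZ conjU_orthproj.
Qed.

(** Conjugation passes through the three factors; the frame hypothesis enters at the inverse of the
    frame operator. *)
Lemma loss_op_img U W w V v i : unitary ip U -> fusion_frame W w ->
  loss_op ip (fun i => U @: W i)%VS w (fun i => U @: V i)%VS v i =
  conjU ip U (loss_op ip W w V v i).
Proof.
move=> unitU Wf; rewrite conjUZ !conjU_comp // conjU_inv ?fusion_op_inj //.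
by rewrite -fusion_op_img // -!conjU_orthproj.
Qed.

Lemma dual_fusion_frame_img U W w V v : unitary ip U -> fusion_frame W w ->
  dual_fusion_frame ip W w V v ->
  dual_fusion_frame ip (fun i => U @: W i)%VS w (fun i => U @: V i)%VS v.
Proof.
move=> unitU Wf [v_gt0 dualV]; split=> //.
under eq_bigr do rewrite loss_op_img //.
by rewrite -conjU_sum dualV conjU1.
Qed.

Lemma one_loss_img U W w V v : unitary ip U -> fusion_frame W w ->
  one_loss ip (fun i => U @: W i)%VS w (fun i => U @: V i)%VS v =
  one_loss ip W w V v.
Proof.
move=> unitU Wf; apply: eq_bigr => i _.
by rewrite loss_op_img // conjU_frobenius.
Qed.

(** Stated between functions, so that a whole family can be rewritten at once. *)
Lemma unitary_img_funK U W : unitary ip U ->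
  (fun i => adjoint ip U @: (U @: W i))%VS = W.
Proof. by move=> unitU; apply/boolp.funext => i; exact: unitary_imgK. Qed.

Local Open Scope classical_set_scope.

(** Repeats the set under [inf] in [one_loss_optimal], so that it can be folded there. *)
Definition dual_losses W w :=
  [set r | exists Z z, dual_fusion_frame ip W w Z z /\ r = one_loss ip W w Z z].

Lemma dual_losses_sub U W w : unitary ip U -> fusion_frame W w ->
  dual_losses W w `<=` dual_losses (fun i => U @: W i)%VS w.
Proof.
move=> unitU Wf _ [Z [z [dualZ ->]]]; exists (fun i => U @: Z i)%VS, z.
by split; [exact: dual_fusion_frame_img | rewrite one_loss_img].
Qed.

Lemma dual_losses_img U W w : unitary ip U -> fusion_frame W w ->
  dual_losses (fun i => U @: W i)%VS w = dual_losses W w.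
Proof.
move=> unitU Wf; apply/seteqP; split; last exact: dual_losses_sub.
(* The reverse inclusion is the same lemma for [adjoint U] and the transported frame, whose image
   under [adjoint U] is [W]. *)
rewrite -{2}(unitary_img_funK W unitU).
exact: dual_losses_sub (unitary_adjoint unitU) (fusion_frame_img unitU Wf).
Qed.

Lemma one_loss_optimal_img U W w V v : unitary ip U -> fusion_frame W w ->
  one_loss_optimal ip W w V v ->
  one_loss_optimal ip (fun i => U @: W i)%VS w (fun i => U @: V i)%VS v.
Proof.
move=> unitU Wf [dualV optV]; split; first exact: dual_fusion_frame_img.
by rewrite one_loss_img // optV -!/(dual_losses _ _) dual_losses_img.
Qed.

End FusionFrames.

Theorem theorem4p7 (R : realType) (k : scalar_kind) (H : vectType (scalars R k))
    (ip : hilbert_dot R k H) (m : nat)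
    (W : 'I_m -> {vspace H}) (w : 'I_m -> R)
    (V : 'I_m -> {vspace H}) (v : 'I_m -> R) (U : 'End(H)) :
  fusion_frame W w -> nontrivial W -> unitary ip U ->
  one_loss_optimal ip W w V v <->
  one_loss_optimal ip (fun i => (U @: W i)%VS) w (fun i => (U @: V i)%VS) v.
Proof.
move=> Wf _ unitU; split; first exact: one_loss_optimal_img.
(* The converse is the forward direction for [adjoint U], which carries both transported families
   back to the original ones. *)
move/(one_loss_optimal_img (unitary_adjoint unitU) (fusion_frame_img unitU Wf)).
by rewrite !unitary_img_funK.
Qed.
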